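(* Let $B_\mu\subset S_\mu$ be closed in $S_\mu$. Suppose that $V:S_\mu\to E$ is a locally Lipschitz mapping with $V(u)\in T_uS_\mu$ for any $u\in S_\mu$, and define $\eta(t,\cdot)$ with values in $S_\mu$ by $$\frac{\partial}{\partial t}\eta(t,u)=V(\eta(t,u)),\qquad \eta(0,u)=u .$$ For $u\in S_\mu$ let $T_u>0$ be the maximal time such that $\eta(\cdot,u)$ exists, and let $B^*\subset S_\mu$ be an open subset such that $\eta(t,u)\in B^*$ for any $u\in B^*$ and all $0<t<T_u$. Then, if $$\lim_{s\searrow0}s^{-1}\operatorname{dist}(u+sV(u),B_\mu)=0,\qquad\forall u\in B_\mu\cap B^*,$$ it holds that $\eta(t,u)\in B_\mu\cap B^*$ for any $u\in B_\mu\cap B^*$ and all $0<t<T_u$.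
   Context: $(E,\langle\cdot,\cdot\rangle)$ and $(H,(\cdot,\cdot))$ are two infinite-dimensional real Hilbert spaces with $E\hookrightarrow H\hookrightarrow E'$ with continuous injections; the injection $E\hookrightarrow H$ has norm at most $1$ and $E$ is identified with its image in $H$. For $u\in E$, $\|u\|^2=\langle u,u\rangle$ and $|u|^2=(u,u)$. For $\mu\in(0,\infty)$, $S_\mu=\{u\in E:|u|^2=\mu\}$ (with the topology of $E$), and for $w\in S_\mu$, $T_wS_\mu=\{\phi\in E:(\phi,w)=0\}$. The distance $\operatorname{dist}$ is taken with respect to the norm $\|\cdot\|$ of $E$. *)

(* Defs.v *)
From HB Require Import structures.
From mathcomp Require Import all_boot all_order all_algebra.
From mathcomp Require Import all_classical all_reals all_analysis.

Set Implicit Arguments.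
Unset Strict Implicit.
Unset Printing Implicit Defensive.

Import Order.TTheory GRing.Theory Num.Theory.
Import numFieldNormedType.Exports.

Local Open Scope classical_set_scope.
Local Open Scope ring_scope.

Definition infinite_dimensional (R : realType) (V : lmodType R) : Prop :=
  ~ exists (n : nat) (e : 'I_n -> V),
      forall v : V, exists c : 'I_n -> R, v = \sum_(i < n) c i *: e i.

(* A real Hilbert space is a complete normed module together with an inner
   product inducing its norm. *)
Definition induces_norm (R : realType) (V : normedModType R)
    (ip : {dot V for idfun}) : Prop :=
  forall v : V, `|v| ^+ 2 = ip v v.

(* E and H are different types: the identification of E with a subspace of H
   is the map iota. The map H -> E' sends h to the functional
   u |-> (h, iota u); its continuity follows from that of iota. *)
Definition hilbert_embedding (R : realType) (E H : normedModType R)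
    (ipH : {dot H for idfun}) (iota : {linear E -> H}) : Prop :=
  [/\ injective iota,
      forall u : E, `|iota u| <= `|u| &
      injective (fun (h : H) (u : E) => ipH h (iota u))].

Definition sphere (R : realType) (E H : normedModType R)
    (ipH : {dot H for idfun}) (iota : {linear E -> H}) (mu : R) : set E :=
  [set u | ipH (iota u) (iota u) = mu].

Definition tangent_space (R : realType) (E H : normedModType R)
    (ipH : {dot H for idfun}) (iota : {linear E -> H}) (w : E) : set E :=
  [set phi | ipH (iota phi) (iota w) = 0].

(* x solves x' = V x, x 0 = u on [0, T[ with values in S; the derivative at 0
   is the right one, and the values of x outside [0, T[ are irrelevant. *)
Definition solution (R : realType) (E : normedModType R) (S : set E)
    (V : E -> E) (u : E) (T : \bar R) (x : R -> E) : Prop :=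
  [/\ x 0 = u,
      forall t : R, 0 <= t -> (t%:E < T)%E -> S (x t),
      h^-1 *: (x h - x 0) @[h --> 0^'+] --> V (x 0) &
      forall t : R, 0 < t -> (t%:E < T)%E -> is_derive t 1 x (V (x t))].

Definition maximal_solution (R : realType) (E : normedModType R) (S : set E)
    (V : E -> E) (u : E) (T : \bar R) (x : R -> E) : Prop :=
  [/\ (0 < T)%E,
      solution S V u T x &
      forall (T' : \bar R) (y : R -> E),
        (0 < T')%E -> solution S V u T' y -> (T' <= T)%E].

(* Main.v *)
(* Let x be an integral curve of V through a point x a of B. Near x a, instead
   of building Euler polygons in B, apply Zorn's lemma to the pairs (t, y) with
   y in B and |x t - y| <= 4 e (t - a), ordered by |z - y| <= M (s - t).
   Completeness makes every chain bounded; the tangency condition and the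
   Lipschitz estimate for V let one step forward from any pair with t < b, so a
   maximal pair has t = b. As e is arbitrary and B is closed, x b lies in B.
   Real induction then carries x along its whole interval of existence. *)

Require Import Defs.
From HB Require Import structures.
From mathcomp Require Import all_boot all_order all_algebra.
From mathcomp Require Import all_classical all_reals all_analysis.
From mathcomp Require Import ring lra.

Set Implicit Arguments.
Unset Strict Implicit.
Unset Printing Implicit Defensive.

Import Order.TTheory GRing.Theory Num.Theory.
Import numFieldNormedType.Exports.

Local Open Scope classical_set_scope.
Local Open Scope ring_scope.

(** * Distance to a set and induction along a segment *)

Lemma edist_inf_lt (R : realType) (E : normedModType R) (B : set E) (z : E)
    (e : R) :
  (edist_inf B z < e%:E)%E -> exists2 b, B b & `|z - b| < e.
Proof.
move=> /ereal_inf_lt[_ [b Bb <-] /edist_lt_ball].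
by rewrite -ball_normE; exists b.
Qed.

(** The supremum of the points up to which [P] holds satisfies [P] by the left condition. It equals
    [b], for otherwise the right condition would lead past it. *)
Lemma real_induction (R : realType) (P : R -> Prop) (a b : R) :
  P a ->
  (forall t, a < t <= b -> (forall s, a <= s < t -> P s) -> P t) ->
  (forall t, a <= t < b -> P t ->
     exists2 d, t < d & forall s, t <= s <= d -> P s) ->
  forall t, a <= t <= b -> P t.
Proof.
move=> Pa Pleft Pright t /andP[at_ tb].
pose G := [set s | a <= s <= b /\ forall r, a <= r <= s -> P r].
have ab : a <= b by exact: le_trans tb.
have Ga : G a.
  split; first by rewrite lexx.
  by move=> r; rewrite -eq_le => /eqP <-.
have supG : has_sup G by split; [exists a|exists b => s [/andP[]]].
have aS : a <= sup G by exact: sup_upper_bound.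
have Sb : sup G <= b by apply: ge_sup; [exists a|move=> s [/andP[]]].
have PltS s : a <= s < sup G -> P s.
  move=> /andP[as_ sS].
  have [r [_ Pr] sr] := @sup_adherent _ G (sup G - s) ltac:(lra) supG.
  by apply: Pr; lra.
have PS : P (sup G).
  have [<-//|aneS] := eqVneq a (sup G).
  by apply: Pleft => //; rewrite lt_neqAle aneS aS.
have PleS s : a <= s <= sup G -> P s.
  move=> /andP[as_]; rewrite le_eqVlt => /predU1P[->//|sS].
  by apply: PltS; rewrite as_.
have [Sltb|] := ltP (sup G) b; last by move=> bS; apply: PleS; lra.
have [d Sd Pd] := Pright (sup G) ltac:(lra) PS.
(* [d] may exceed [b], which points of [G] may not; the minimum still lies beyond [sup G]. *)
have : G (Num.min d b).
  have mS : sup G < Num.min d b by rewrite lt_min Sd.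
  have md : Num.min d b <= d by rewrite ge_min lexx.
  have mb : Num.min d b <= b by rewrite ge_min lexx orbT.
  split; first by lra.
  move=> r /andP[ar rm]; have [rS|/ltW Sr] := leP r (sup G).
    by apply: PleS; rewrite ar.
  by apply: Pd; lra.
by move=> /(sup_upper_bound supG); rewrite leNgt lt_min Sd Sltb.
Qed.

(** * Maximal elements for the cone order *)

(* The order in Zorn's lemma is that of the cone |y| <= M t, as in the
   Bishop-Phelps theorem. *)
Lemma cone_maximal (R : realType) (E : completeNormedModType R)
    (Z : set (R * E)) (M d : R) :
  0 < M -> Z !=set0 -> closed Z -> (forall p, Z p -> p.1 <= d) ->
  exists2 p, Z p &
    forall q, Z q -> `|q.2 - p.2| <= M * (q.1 - p.1) -> q.1 <= p.1.
Proof.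
move=> M0 [z0 Zz0] cZ Zd.
pose le_cone := [rel p q : {p | Z p} |
  `|(sval q).2 - (sval p).2| <= M * ((sval q).1 - (sval p).1)].
have le_cone1 p q : le_cone p q -> (sval p).1 <= (sval q).1.
  by move=> /(le_trans (normr_ge0 _)); rewrite pmulr_rge0// subr_ge0.
have le_refl p : le_cone p p by rewrite /= !subrr normr0 mulr0.
have le_tr p q r : le_cone p q -> le_cone q r -> le_cone p r.
  move=> /= pq qr; rewrite -(subrKA (sval q).2).
  by rewrite (le_trans (ler_normD _ _))//; move: pq qr; lra.
(* For a preorder, maximality of [p] says that any [q] above [p] is also below it; [le_cone1] turns
   this into [q.1 <= p.1]. *)
have [A totA|[p Zp] pmax] :=
    ZL_preorder (exist _ _ Zz0) le_refl le_tr; last first.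
  exists p => // q Zq pq.
  exact: (le_cone1 (exist _ q Zq) (exist _ p Zp) (pmax (exist _ q Zq) pq)).
have [[a0 Aa0]|A0] := pselect (A !=set0); last first.
  by exists (exist _ _ Zz0) => s As; case: A0; exists s.
(* The tails of the chain generate a filter; its limit will be the upper bound. *)
pose F : set_system (R * E) :=
  [set U | exists2 a, A a & forall b, A b -> le_cone a b -> U (sval b)].
have FF : ProperFilter F.
  split; first by move=> [a Aa /(_ a Aa (le_refl a))].
  split.
  - by exists a0.
  - move=> U W [a Aa aU] [b Ab bW].
    have [ab|ba] := totA _ _ Aa Ab.
      exists b => // c Ac bc; split; last exact: bW.
      by apply: aU => //; exact: le_tr bc.
    exists a => // c Ac ac; split; first exact: aU.
    by apply: bW => //; exact: le_tr ac.
  - by move=> U W UW [a Aa aU]; exists a => // b Ab /(aU _ Ab) /UW.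
pose G := [set (sval a).1 | a in A].
have supG : has_sup G.
  by split; [exists (sval a0).1, a0|exists d => _ [[a Za] _ <-]; exact: Zd].
have Fsup : p.1 @[p --> F] --> sup G.
  apply/cvgrPdist_le => e e0.
  have [_ [a Aa <-] ae] := sup_adherent e0 supG.
  exists a => // b Ab /le_cone1 ab /=.
  have bS : (sval b).1 <= sup G by apply: sup_upper_bound => //; exists b.
  by rewrite ger0_norm; lra.
(* Beyond an [a] whose time is within [e / M] of [sup G], the cone inequality confines the second
   coordinates to the [e]-ball around [(sval a).2]. *)
have Fcvg : cvg (p.2 @[p --> F]).
  apply: cauchy_cvg; apply: cauchy_exP => e e0.
  have [_ [a Aa <-] ae] := sup_adherent (divr_gt0 e0 M0) supG.
  exists (sval a).2; exists a => // b Ab ab; rewrite -ball_normE /=.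
  rewrite distrC (le_lt_trans ab)// -ltr_pdivlMl// mulrC.
  have bS : (sval b).1 <= sup G by apply: sup_upper_bound => //; exists b.
  by lra.
pose z := (sup G, lim (p.2 @[p --> F])).
have Fz : p @[p --> F] --> z.
  rewrite (_ : (fun p : R * E => p) = fun p => (p.1, p.2)); last first.
    by apply/funext => -[].
  exact: (cvg_pair (F:=F) Fsup Fcvg).
have Zz : Z z.
  by apply: (@closed_cvg _ _ F _ (fun p => p) Z cZ _ z Fz);
    exists a0 => // -[b Zb].
exists (exist _ z Zz) => a Aa /=; rewrite -subr_ge0.
(* The cone is closed, so the inequality between [a] and the tail of the chain passes to [z]. *)
have cvgR : M * (p.1 - (sval a).1) - `|p.2 - (sval a).2| @[p --> F] -->
    M * (z.1 - (sval a).1) - `|z.2 - (sval a).2|.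
  apply: cvgB; first by apply: cvgMr; apply: cvgB => //; exact: cvg_cst.
  by apply: cvg_norm; apply: cvgB => //; exact: cvg_cst.
have := @closed_cvg _ _ F _ _ (fun r : R => 0 <= r) (@closed_ge R 0) _ _ cvgR.
apply.
by exists a => // b Ab ab; rewrite /= subr_ge0.
Qed.

(** * Viability of a closed set along a curve *)

(** Supplies the closed set for [cone_maximal]. Limits are taken along the trace of [nbhs p] on the
    tube, where times stay in [[a, b]], so continuity of [x] within that segment is enough. *)
Lemma closed_tube (R : realType) (E : normedModType R) (B : set E)
    (x : R -> E) (a b K : R) :
  closed B -> {within `[a, b], continuous x} ->
  closed [set p : R * E |
    [/\ a <= p.1 <= b, B p.2 & `|x p.1 - p.2| <= K * (p.1 - a)]].
Proof.
move=> cB cx p Zp; set Z := (X in closure X) in Zp.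
have FF : ProperFilter (within Z (nbhs p)) by exact: within_nbhs_proper.
have F1 : q.1 @[q --> within Z (nbhs p)] --> p.1.
  by apply: cvg_trans; [exact: cvg_within_filter|exact: cvg_fst].
have F2 : q.2 @[q --> within Z (nbhs p)] --> p.2.
  by apply: cvg_trans; [exact: cvg_within_filter|exact: cvg_snd].
have FZ : \forall q \near within Z (nbhs p), Z q by exact: withinT.
have pab : a <= p.1 <= b.
  have cI : closed `[a, b] by exact: interval_closed.
  have := @closed_cvg _ _ _ FF _ _ cI _ _ F1.
  by rewrite /= in_itv /=; apply; apply: filterS FZ => q [].
have Bp : B p.2.
  by apply: (@closed_cvg _ _ _ FF _ _ cB _ _ F2); apply: filterS FZ => q [].
split => //; rewrite -subr_ge0.
have xF : x q.1 @[q --> within Z (nbhs p)] --> x p.1.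
  move/subspace_continuousP : cx => /(_ p.1); rewrite /= in_itv /= => /(_ pab).
  move=> xp U /xp /F1 UF; apply: filterS2 FZ UF => q [qab _ _]; apply.
  by rewrite /= in_itv.
have cvgR : K * (q.1 - a) - `|x q.1 - q.2| @[q --> within Z (nbhs p)] -->
    K * (p.1 - a) - `|x p.1 - p.2|.
  apply: cvgB; first by apply: cvgMr; apply: cvgB => //; exact: cvg_cst.
  by apply: cvg_norm; exact: cvgB.
have := @closed_cvg _ _ _ FF _ _ (@closed_ge R 0) _ _ cvgR; apply.
by apply: filterS FZ => q []; rewrite /= subr_ge0.
Qed.

(* The factor 4 absorbs the two one-step errors e h and the Lipschitz term
   k h (4 e (t - a)) <= 2 e h. *)
Lemma approx_viable (R : realType) (E : completeNormedModType R) (B : set E)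
    (V : E -> E) (x : R -> E) (a b k M e : R) :
  a <= b -> 0 < e -> 0 < M -> 0 <= k -> k * (b - a) <= 2^-1 ->
  closed B -> B (x a) -> {within `[a, b], continuous x} ->
  (forall t, a <= t < b ->
    \forall h \near 0^'+, `|x (t + h) - x t - h *: V (x t)| <= e * h) ->
  (forall t y, a <= t < b -> B y -> `|x t - y| <= 4 * e * (t - a) ->
    [/\ `|V (x t) - V y| <= k * `|x t - y|, `|V y| + e <= M &
        \forall h \near 0^'+, exists2 z, B z & `|y + h *: V y - z| <= e * h]) ->
  exists2 y, B y & `|x b - y| <= 4 * e * (b - a).
Proof.
move=> ab e0 M0 k0 kab cB Ba cx dx tanB.
have [| |p [/andP[ap pb] Bp xp] pmax] :=
    cone_maximal M0 _ (closed_tube (K := 4 * e) cB cx) (d := b).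
- by exists (a, x a); rewrite /= lexx ab !subrr normr0 mulr0.
- by move=> p [/andP[]].
have [pltb|bp] := ltP p.1 b; last first.
  have pE : p.1 = b by apply/eqP; rewrite eq_le pb.
  by exists p.2; rewrite // -pE.
have [Vk VM tan] := tanB p.1 p.2 ltac:(lra) Bp xp.
(* As [p.1 < b], a small step reaches [(p.1 + h, z)], still in the tube and above [p] in the cone
   order, against maximality. *)
near (0 : R)^'+ => h.
have h0 : 0 < h by near: h; exact: nbhs_right_gt.
have hb : h < b - p.1 by near: h; apply: nbhs_right_lt; rewrite subr_gt0.
have [z Bz zh] : exists2 z, B z & `|p.2 + h *: V p.2 - z| <= e * h by near: h.
have xh : `|x (p.1 + h) - x p.1 - h *: V (x p.1)| <= e * h.
  by near: h; apply: dx; lra.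
have : p.1 + h <= p.1.
  apply: (pmax (p.1 + h, z)) => /=.
    split => //; first by lra.
    (* The terms are the expansion error of [x], the gap at [p], the drift between the two
       velocities and the tangency error. *)
    have -> : x (p.1 + h) - z = (x (p.1 + h) - x p.1 - h *: V (x p.1)) +
        (x p.1 - p.2) + h *: (V (x p.1) - V p.2) + (p.2 + h *: V p.2 - z).
      rewrite scalerBr [in RHS](addrAC (x _)) subrKA.
      by rewrite [in RHS](addrAC (x _)) subrKA -(addrA (x _)) -opprD subrKA.
    rewrite (le_trans (ler_normD _ _))//.
    have := ler_normD (x (p.1 + h) - x p.1 - h *: V (x p.1) + (x p.1 - p.2))
      (h *: (V (x p.1) - V p.2)).
    have := ler_normD (x (p.1 + h) - x p.1 - h *: V (x p.1)) (x p.1 - p.2).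
    rewrite normrZ gtr0_norm//.
    have := ler_wpM2l (ltW h0) Vk.
    have kxp : k * `|x p.1 - p.2| <= 2 * e.
      have kpa : k * (p.1 - a) <= 2^-1.
        by rewrite (le_trans _ kab)// ler_wpM2l// lerB.
      rewrite (le_trans (ler_wpM2l k0 xp))// mulrCA.
      by have := ler_wpM2l (ltW e0) kpa; lra.
    have := ler_wpM2l (ltW h0) kxp.
    lra.
  (* The step has length at most [h (|V p.2| + e) <= M h], as the cone order requires. *)
  have -> : z - p.2 = h *: V p.2 - (p.2 + h *: V p.2 - z).
    by rewrite opprB opprD addrCA [X in _ = _ + X]addrCA subrr addr0.
  rewrite (le_trans (ler_normB _ _))// normrZ gtr0_norm//.
  have := ler_wpM2l (ltW h0) VM.
  lra.
by lra.
Unshelve. all: by end_near. Qed.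

(** The time [d] is fixed before [e]; letting [e] shrink in [approx_viable] gives points of [B]
    arbitrarily close to [x t], and [B] is closed. *)
Lemma viable_right (R : realType) (E : completeNormedModType R) (S B : set E)
    (V : E -> E) (x : R -> E) (a c k r : R) :
  a < c -> 0 < k -> 0 < r -> closed B -> B `<=` S -> B (x a) ->
  {within `[a, c], continuous x} -> (forall t, a <= t <= c -> S (x t)) ->
  (forall t e, a <= t < c -> 0 < e ->
    \forall h \near 0^'+, `|x (t + h) - x t - h *: V (x t)| <= e * h) ->
  (forall y z, S y -> S z -> `|x a - y| < r -> `|x a - z| < r ->
    `|V y - V z| <= k * `|y - z|) ->
  (forall y e, B y -> `|x a - y| < r -> 0 < e ->
    \forall h \near 0^'+, exists2 z, B z & `|y + h *: V y - z| <= e * h) ->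
  exists2 d, a < d & forall t, a <= t <= d -> B (x t).
Proof.
move=> ac k0 r0 cB BS Ba cx Sx dx lipV tanB.
have [_ /cvgrPdist_lt/(_ (r / 2)) + _] := (continuous_within_itvP x ac).1 cx.
move=> /(_ (divr_gt0 r0 (ltr0n _ 2)))[d0 /= d00 xr2].
(* The three bounds keep [[a, d]] inside [[a, c]], keep [x] within [r / 2] of [x a], and give
   [k (d - a) <= 1/2]. *)
pose d := Num.min (Num.min c (a + d0 / 2)) (a + (2 * k)^-1).
have k2 : 0 < (2 * k)^-1 by rewrite invr_gt0 mulr_gt0.
have ad : a < d by rewrite !lt_min ac !ltrDl k2 divr_gt0.
have dc : d <= c by rewrite !ge_min lexx.
have dd0 : d <= a + d0 / 2 by rewrite !ge_min lexx orbT.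
have dk : d - a <= (2 * k)^-1 by rewrite lerBlDl ge_min lexx orbT.
have xr t : a <= t <= d -> `|x a - x t| < r / 2.
  move=> /andP[]; rewrite le_eqVlt => /predU1P[<- _|at_ td].
    by rewrite subrr normr0 divr_gt0.
  by apply: xr2 => //=; rewrite distrC gtr0_norm; lra.
exists d => // t /andP[at_ td].
rewrite ((closure_id B).1 cB) => U /nbhs_normP[rho /= rho0 rhoU].
have [m [m0 mrho mr]] : exists m, [/\ 0 < m, m <= rho & m <= r / 2].
  exists (Num.min rho (r / 2)).
  by rewrite lt_min !ge_min !lexx orbT rho0 divr_gt0.
(* The tube then has radius at most [m / 2] up to time [d], so its points are within [rho] of the
   curve and within [r] of [x a]. *)
pose e := m / (8 * (d - a)).
have e0 : 0 < e by rewrite divr_gt0// mulr_gt0// subr_gt0.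
have em s : a <= s <= d -> 4 * e * (s - a) < m.
  move=> /andP[as_ sd]; apply: (@le_lt_trans _ _ (4 * e * (d - a))).
    by rewrite ler_wpM2l ?lerB// mulr_ge0// ltW.
  rewrite (_ : 4 * e * (d - a) = m / 2); first by lra.
  by rewrite /e; field; lra.
(* The Lipschitz estimate on the ball bounds [|V y|] by [|V (x a)| + k * r], whence the value of
   [M]. *)
have [] := @approx_viable _ E B V x a t k (`|V (x a)| + k * r + e) e => //.
- by rewrite ltr_wpDl// addr_ge0// mulr_ge0// ltW.
- exact: ltW.
- apply: (@le_trans _ _ (k * (2 * k)^-1)).
    by apply: ler_wpM2l (ltW k0) _ _ _; lra.
  by rewrite le_eqVlt; apply/orP; left; apply/eqP; field; lra.
- apply: continuous_subspaceW cx; apply: subset_itvl; rewrite bnd_simp; lra.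
- by move=> s sat; apply: dx => //; lra.
- move=> s y /andP[as_ st] By xsy.
  have ya : `|x a - y| < r.
    have := ler_distD (x s) (x a) y.
    have := xr s ltac:(lra); have := em s ltac:(lra).
    by lra.
  have sa : `|x a - x s| < r by have := xr s ltac:(lra); lra.
  have Vy : `|V y - V (x a)| <= k * r.
    rewrite (le_trans (lipV _ _ (BS _ By) (BS _ Ba) ya _))// ?subrr ?normr0//.
    by rewrite distrC ler_wpM2l ?ltW.
  split.
  + by apply: lipV => //; [apply: Sx; lra|exact: BS].
  + rewrite lerD2r -(subrK (V (x a)) (V y)) addrC.
    by rewrite (le_trans (ler_normD _ _))// lerD2l.
  + exact: tanB.
move=> y By xty; exists y; split => //; apply: rhoU => /=.
by have := em t ltac:(lra); lra.
Qed.

(** * Right expansions and continuity of solutions *)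

Lemma diff_quotient_right (R : realType) (E : normedModType R) (x : R -> E)
    (t e : R) (v : E) :
  0 < e -> h^-1 *: (x (t + h) - x t) @[h --> 0^'+] --> v ->
  \forall h \near 0^'+, `|x (t + h) - x t - h *: v| <= e * h.
Proof.
move=> e0 /cvgrPdist_le/(_ e e0) xv; near=> h.
have h0 : 0 < h by near: h; exact: nbhs_right_gt.
have : `|v - h^-1 *: (x (t + h) - x t)| <= e by near: h.
rewrite -(ler_pM2l h0) -{1}(gtr0_norm h0) -normrZ scalerBr scalerA.
by rewrite divff ?gt_eqF// scale1r distrC [h * e]mulrC.
Unshelve. all: by end_near. Qed.

(** One estimate covers time [0], where only the right derivative is given, and later times, where
    the two-sided derivative is restricted to the right. *)
Lemma solution_right (R : realType) (E : normedModType R) (S : set E)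
    (V : E -> E) (u : E) (T : \bar R) (x : R -> E) (t e : R) :
  solution S V u T x -> 0 <= t -> (t%:E < T)%E -> 0 < e ->
  \forall h \near 0^'+, `|x (t + h) - x t - h *: V (x t)| <= e * h.
Proof.
move=> [_ _ x0 xt] t_ge0 tT e0; apply: diff_quotient_right => //; move: t_ge0.
rewrite le_eqVlt => /predU1P[<-|t0].
  by under eq_fun do rewrite add0r.
have [xd <-] := xt t t0 tT; apply: cvg_dnbhs_at_right.
move: xd; rewrite /derivable /derive => xd.
have -> : (fun h : R => h^-1 *: (x (t + h) - x t)) =
    (fun h => h^-1 *: ((x \o shift t) (h *: 1) - x t)).
  by apply: funext => h /=; rewrite [h%:A]mulr1 (addrC t).
exact: xd.
Qed.

Lemma solution_continuous (R : realType) (E : normedModType R) (S : set E)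
    (V : E -> E) (u : E) (T : \bar R) (x : R -> E) (b : R) :
  solution S V u T x -> 0 < b -> (b%:E < T)%E ->
  {within `[0, b], continuous x}.
Proof.
move=> sol b0 bT; have xt t : 0 < t -> t <= b -> {for t, continuous x}.
  move=> t0 tb; have [_ _ _ /(_ t t0)] := sol.
  case=> [|xd _]; first by rewrite (le_lt_trans _ bT)// lee_fin.
  exact/differentiable_continuous/derivable1_diffP.
apply/continuous_within_itvP => //; split.
- by move=> t; rewrite in_itv /= => /andP[t0 /ltW]; exact: xt.
(* The expansion with error [1 * h] shows that [x] moves by at most [h (1 + |V (x 0)|)]. *)
- apply/cvgrPdist_le => e e0; near=> h.
  have h0 : 0 < h by near: h; exact: nbhs_right_gt.
  have : `|x (0 + h) - x 0 - h *: V (x 0)| <= 1 * h.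
    by near: h; apply: (solution_right sol); rewrite ?(lt_trans _ bT) ?lte_fin.
  have hV : h * (1 + `|V (x 0)|) <= e.
    rewrite -ler_pdivlMr ?ltr_wpDr//; near: h; apply: nbhs_right_le.
    by rewrite divr_gt0// ltr_wpDr.
  have := ler_normD (x h - x 0 - h *: V (x 0)) (h *: V (x 0)).
  by rewrite subrK normrZ gtr0_norm// add0r distrC; lra.
- by apply: cvg_at_left_filter; apply: xt.
Unshelve. all: by end_near. Qed.

(** * The sphere and local data around its points *)

Lemma sphere_closed (R : realType) (E H : normedModType R)
    (ipH : {dot H for idfun}) (iota : {linear E -> H}) (mu : R) :
  induces_norm ipH -> hilbert_embedding ipH iota ->
  closed (sphere ipH iota mu).
Proof.
move=> hH [_ iota_le _].
have -> : sphere ipH iota mu = (fun u => `|iota u| ^+ 2) @^-1` [set mu].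
  by apply/seteqP; split=> u; rewrite /sphere /= hH.
apply: preimage_closed (@closed_eq _ _) => u _.
have iota_cvg : iota v @[v --> u] --> iota u.
  apply/cvgrPdist_le => e e0; apply/nbhs_normP; exists e => // v /= /ltW uv.
  by rewrite -linearB; exact: le_trans (iota_le _) uv.
exact: (cvgM (cvg_norm iota_cvg) (cvg_norm iota_cvg)).
Qed.

(** The local condition concerns pairs; at the diagonal point [(p, p)] its two neighbourhoods
    contain a common ball. *)
Lemma locally_lipschitz_ball (R : realType) (E F : normedModType R) (S : set E)
    (V : E -> F) (p : E) :
  [locally [lipschitz V x | x in S]] -> S p ->
  exists k r, [/\ 0 < k, 0 < r & forall y z, S y -> S z ->
    `|p - y| < r -> `|p - z| < r -> `|V y - V z| <= k * `|y - z|].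
Proof.
move=> /(_ (p, p)) + Sp => /(_ (conj Sp Sp)) /pinfty_ex_gt0[k k0].
move=> [[A B] /= [/nbhs_normP[r1 /= r10 r1A] /nbhs_normP[r2 /= r20 r2B]] lip].
exists k, (Num.min r1 r2); split; rewrite // ?lt_min ?r10 // => y z Sy Sz.
rewrite !lt_min => /andP[y1 _] /andP[_ z2].
by apply: (lip (y, z)) => //; split => /=; [exact: r1A|exact: r2B].
Qed.

Lemma open_subspace_ball (R : realType) (E : normedModType R) (S A : set E)
    (p : E) :
  A `<=` S -> open (A : set (subspace S)) -> A p ->
  exists2 r, 0 < r & forall y, S y -> `|p - y| < r -> A y.
Proof.
move=> AS /open_subspaceP[U openU UA] Ap.
have [Up _] : (U `&` S) p by rewrite UA; split => //; exact: AS.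
have /nbhs_normP[r /= r0 rU] : nbhs p U by exact: open_nbhs_nbhs.
exists r => // y Sy py; suff [] : (A `&` S) y by [].
by rewrite -UA; split => //; exact: rU.
Qed.

Lemma tangent_approx (R : realType) (E : normedModType R) (B : set E)
    (y v : E) (e : R) :
  ((s^-1)%:E * edist_inf B (y + s *: v)%R)%E @[s --> 0^'+] --> 0%E -> 0 < e ->
  \forall h \near 0^'+, exists2 z, B z & `|y + h *: v - z| <= e * h.
Proof.
move=> tan e0; near=> h.
have h0 : 0 < h by near: h; exact: nbhs_right_gt.
have : ((h^-1)%:E * edist_inf B (y + h *: v)%R < e%:E)%E.
  near: h.
  have lte : nbhs 0%E [set r : \bar R | (r < e%:E)%E].
    by apply: open_ereal_lt'; rewrite lte_fin.
  exact: tan lte.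
rewrite lte_pdivrMl// -EFinM mulrC => /edist_inf_lt[z Bz zh].
by exists z => //; exact: ltW.
Unshelve. all: by end_near. Qed.

(** * Invariance under the flow *)

Theorem corollary4p6 (R : realType) (E H : completeNormedModType R)
    (ipE : {dot E for idfun}) (ipH : {dot H for idfun})
    (hE : induces_norm ipE) (hH : induces_norm ipH)
    (dimE : infinite_dimensional E) (dimH : infinite_dimensional H)
    (iota : {linear E -> H}) (hiota : hilbert_embedding ipH iota)
    (mu : R) (mu_gt0 : 0 < mu)
    (B : set E) (subB : B `<=` sphere ipH iota mu)
    (closedB : closed (B : set (subspace (sphere ipH iota mu))))
    (V : E -> E)
    (lipV : [locally [lipschitz V x | x in sphere ipH iota mu]])
    (tanV : forall u : E, sphere ipH iota mu u ->
       tangent_space ipH iota u (V u))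
    (eta : R -> E -> E) (T : E -> \bar R)
    (flow : forall u : E, sphere ipH iota mu u ->
       maximal_solution (sphere ipH iota mu) V u (T u) (eta ^~ u))
    (Bs : set E) (subBs : Bs `<=` sphere ipH iota mu)
    (openBs : open (Bs : set (subspace (sphere ipH iota mu))))
    (invBs : forall (u : E) (t : R), Bs u -> 0 < t -> (t%:E < T u)%E ->
       Bs (eta t u))
    (distB : forall u : E, (B `&` Bs) u ->
       ((s^-1)%:E * edist_inf B (u + s *: V u)%R)%E @[s --> 0^'+] --> 0%E) :
  forall (u : E) (t : R), (B `&` Bs) u -> 0 < t -> (t%:E < T u)%E ->
    (B `&` Bs) (eta t u).
Proof.
move=> u b [Bu Bsu] b0 bT; split; last exact: invBs.
set S := sphere ipH iota mu in subB closedB lipV flow subBs openBs.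
(* Relative closedness becomes closedness in [E], since the sphere is closed. *)
have cB : closed (B : set E).
  by rewrite -(setIidl subB) (closed_setIS _ (sphere_closed hH hiota)).
have [_ sol _] := flow _ (subB _ Bu).
have [eta0 etaS _ _] := sol.
have etaBs t : 0 <= t -> (t%:E < T u)%E -> Bs (eta t u).
  by rewrite le_eqVlt => /predU1P[<- _|]; [rewrite eta0|exact: invBs].
have tT t : t <= b -> (t%:E < T u)%E.
  by move=> tb; rewrite (le_lt_trans _ bT)// lee_fin.
have cx := solution_continuous sol b0 bT.
apply: (@real_induction R (fun t => B (eta t u)) 0 b).
- by rewrite eta0.
- move=> t /andP[t0 tb] Bt.
  have [_ _ xt] := (continuous_within_itvP _ t0).1
    (solution_continuous sol t0 (tT _ tb)).
  have := @closed_cvg _ _ _ _ _ B cB _ _ xt; apply; near=> s; apply: Bt.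
  apply/andP; split; last by near: s; exact: nbhs_left_lt.
  by near: s; exact: nbhs_left_ge.
- move=> t /andP[t0 tb] Bt.
  have St := subB _ Bt.
  have [k [r1 [k0 r10 lip]]] := locally_lipschitz_ball lipV St.
  have [r2 r20 ballBs] :=
    open_subspace_ball subBs openBs (etaBs t t0 (tT _ (ltW tb))).
  (* Within [r1] the field is Lipschitz on the sphere; within [r2] points of [B] lie in [Bs], where
     [distB] is available. *)
  apply: (@viable_right _ _ S B V (eta ^~ u) t b k (Num.min r1 r2)) => //.
  + by rewrite lt_min r10.
  + by apply: continuous_subspaceW cx; apply: subset_itvr; rewrite bnd_simp.
  + by move=> s /andP[ts sb]; apply: etaS; [exact: le_trans ts|exact: tT].
  + move=> s e /andP[ts sb] e0; apply: (solution_right sol) => //.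
      exact: le_trans ts.
    exact/tT/ltW.
  + move=> y z Sy Sz; rewrite !lt_min => /andP[? _] /andP[? _].
    exact: lip.
  + move=> y e By; rewrite lt_min => /andP[_ y2].
    apply: tangent_approx; apply: distB; split => //.
    by apply: ballBs => //; exact: subB.
- by rewrite lexx andbT ltW.
Unshelve. all: by end_near. Qed.
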